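(* Let $\mathcal V$ be a unital commutative associative algebra with an automorphism $S$ and a multiplicative $\lambda$-bracket $\{\cdot\,_\lambda\,\cdot\}$. Suppose that the pseudodifference operator $L(S)\in\mathcal V((S^{-1}))$ or $L(S)\in\mathcal V((S))$ satisfies the multiplicative 3-Adler identity $$\{L(z)_\lambda L(w)\}=L(w\lambda S)L(z)\,\delta_+\Big(\frac{w\lambda S}z\Big)\Big(L^*\Big(\frac\lambda z\Big)-\frac{w\lambda S}zL(w)\Big)-\Big(L(z)-L(w\lambda S)\frac{w\lambda S}z\Big)\delta_+\Big(\frac{w\lambda S}z\Big)L(w)L^*\Big(\frac\lambda z\Big).$$ Then the multiplicative skewsymmetry relation holds: $$\{L(z)_\lambda L(w)\}=-\sum_n S^{-n}(c_n)\lambda^{-n}\quad\text{where}\quad \{L(w)_\lambda L(z)\}=\sum_n c_n\lambda^n,$$ and the multiplicative Jacobi identity holds: $$\{L(z)_\lambda\{L(w)_\mu L(v)\}\}-\{L(w)_\mu\{L(z)_\lambda L(v)\}\}=\{\{L(z)_\lambda L(w)\}_{\lambda\mu}L(v)\}.$$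
   Context: The base field $\mathbb F$ has characteristic $0$. A multiplicative $\lambda$-bracket on $\mathcal V$ is a linear map $\mathcal V\otimes\mathcal V\to\mathcal V[\lambda,\lambda^{-1}]$, $a\otimes b\mapsto\{a_\lambda b\}$, satisfying: sesquilinearity $\{S(a)_\lambda b\}=\lambda^{-1}\{a_\lambda b\}$, $\{a_\lambda S(b)\}=\lambda S\{a_\lambda b\}$ ($S$ acting on coefficients); left Leibniz rule $\{a_\lambda bc\}=\{a_\lambda b\}c+\{a_\lambda c\}b$; right Leibniz rule $\{ab_\lambda c\}=\sum_n\big(p_nS^n(b)+q_nS^n(a)\big)\lambda^n$, where $\{a_\lambda c\}=\sum_np_n\lambda^n$ and $\{b_\lambda c\}=\sum_nq_n\lambda^n$. (No skewsymmetry or Jacobi identity is assumed.) $\mathcal V((S^{\pm1}))$ means $\mathcal V((S))$ or $\mathcal V((S^{-1}))$, with coefficients on the left and product determined by $S\circ f=S(f)S$, $f\in\mathcal V$. For $L(S)=\sum_nu_nS^n$, the symbol is $L(z)=\sum_nu_nz^n$, the formal adjoint is $L^*(S)=\sum_nS^{-n}\circ u_n$, and $\delta_+(x)=\sum_{k\ge0}x^k$. In the 3-Adler identity: $L(w\lambda S)=\sum_nu_nw^n\lambda^nS^n$, $L^*(\lambda/z)=\sum_nS^{-n}(u_n)\lambda^{-n}z^n$, $\delta_+(w\lambda S/z)=\sum_{k\ge0}w^k\lambda^kz^{-k}S^k$, and each $S$ acts on all coefficients written to its right (e.g. in $L(w\lambda S)L(z)\delta_+(\cdots)(\cdots)$ the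 $S$ of the first factor acts on the coefficients of $L(z)$ and of everything that follows). Each coefficient of $z^iw^j$ is a finite sum. The left-hand side is $\{L(z)_\lambda L(w)\}=\sum_{i,j}\{{u_i}_\lambda u_j\}z^iw^j$; brackets are extended bilinearly over the formal variables. *)

(* Defs.v *)
From HB Require Import structures.
From mathcomp Require Import all_boot all_order all_algebra.
From mathcomp Require Import finmap.
From mathcomp Require Import mathcomp_extra boolp classical_sets functions.
From mathcomp Require Import cardinality fsbigop.

Set Implicit Arguments.
Unset Strict Implicit.
Unset Printing Implicit Defensive.

Import GRing.Theory.
Local Open Scope classical_set_scope.
Local Open Scope ring_scope.

Record algAut (F : fieldType) (V : comAlgType F) := AlgAut {
  aut_fun :> {lrmorphism V -> V};
  aut_inv : V -> V;
  aut_funK : cancel aut_fun aut_inv;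
  aut_invK : cancel aut_inv aut_fun
}.

Definition autz (F : fieldType) (V : comAlgType F) (S : algAut V)
    (n : int) (x : V) : V :=
  match n with
  | Posz k => iter k S x
  | Negz k => iter k.+1 (aut_inv S) x
  end.

(* V[x, x^-1]: P n is the coefficient of x^n. *)
Definition laurent (V : nmodType) := {fsfun int -> V with 0}.

(* A bilinear map V x V -> V[lambda, lambda^-1], subject to axioms that are
   read off on the coefficient of lambda^n. *)
Record mulLambdaBracket (F : fieldType) (V : comAlgType F) (S : algAut V) :=
  MulLambdaBracket {
    mlb :> V -> V -> laurent V;
    mlb_linearl : forall (b : V) (n : int), linear (fun a => mlb a b n);
    mlb_linearr : forall (a : V) (n : int), linear (fun b => mlb a b n);
    (* {S(a)_lambda b} = lambda^-1 {a_lambda b} *)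
    mlb_sesquil : forall (a b : V) (n : int), mlb (S a) b n = mlb a b (n + 1);
    (* {a_lambda S(b)} = lambda S{a_lambda b} *)
    mlb_sesquir : forall (a b : V) (n : int),
      mlb a (S b) n = S (mlb a b (n - 1));
    mlb_leibnizl : forall (a b c : V) (n : int),
      mlb a (b * c) n = mlb a b n * c + mlb a c n * b;
    mlb_leibnizr : forall (a b c : V) (n : int),
      mlb (a * b) c n = mlb a c n * autz S n b + mlb b c n * autz S n a
  }.

(* L : int -> V stands for sum_n L_n S^n. *)
Definition in_laurent_Sinv (V : nmodType) (L : int -> V) : Prop :=
  exists N : int, forall n : int, N < n -> L n = 0.

Definition in_laurent_S (V : nmodType) (L : int -> V) : Prop :=
  exists N : int, forall n : int, n < N -> L n = 0.

(* Formal series in z, w, lambda: X i j n is the coefficient of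
   z^i w^j lambda^n. *)
Definition zwl_series (V : Type) := int -> int -> int -> V.

Section Adler.
Context (F : fieldType) (V : comAlgType F) (S : algAut V) (L : int -> V).
Implicit Type X : zwl_series V.

(* L(w) *)
Definition symb_w : zwl_series V := fun i j n =>
  if (i == 0) && (n == 0) then L j else 0.

(* L^*(lambda/z) = sum_c S^-c(L_c) lambda^-c z^c *)
Definition adj_symb : zwl_series V := fun i j n =>
  if (j == 0) && (n == - i) then autz S (- i) (L i) else 0.

(* L(w) L^*(lambda/z) *)
Definition symb_w_adj_symb : zwl_series V := fun i j n =>
  if n == - i then L j * autz S (- i) (L i) else 0.

(* The operators below multiply on the left by, respectively, L(z),
   L(w lambda S), w lambda S / z and delta_+(w lambda S / z). The sums are over all indices:
   \sum_(a \in A) is 0 if the support is infinite, but on the series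
   occurring in adler_rhs all supports are finite, for L in V((S^-1)) as well
   as for L in V((S)). *)
Definition mul_symb_z X : zwl_series V := fun i j n =>
  \sum_(b \in [set: int]) L b * X (i - b) j n.

Definition mul_op X : zwl_series V := fun i j n =>
  \sum_(a \in [set: int]) L a * autz S a (X i (j - a) (n - a)).

Definition mul_shift X : zwl_series V := fun i j n =>
  S (X (i + 1) (j - 1) (n - 1)).

Definition mul_delta X : zwl_series V := fun i j n =>
  \sum_(k \in [set: nat])
     autz S k%:Z (X (i + k%:Z) (j - k%:Z) (n - k%:Z)).

Definition series_sub X Y : zwl_series V := fun i j n => X i j n - Y i j n.

Definition adler_rhs : zwl_series V :=
  let Y := mul_delta symb_w_adj_symb in
  series_sub
    (mul_op (mul_symb_z (mul_delta (series_sub adj_symb (mul_shift symb_w)))))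
    (series_sub (mul_symb_z Y) (mul_op (mul_shift Y))).

(* {L(z)_lambda L(w)} *)
Definition bracket_series (br : mulLambdaBracket S) : zwl_series V :=
  fun i j n => br (L i) (L j) n.

Definition adler3 (br : mulLambdaBracket S) : Prop :=
  forall i j n : int, bracket_series br i j n = adler_rhs i j n.

(* At z^i w^j: the coefficient of lambda^-n on the two sides, where c_n is the
   coefficient of z^i w^j lambda^n in {L(w)_lambda L(z)}. *)
Definition mul_skewsymmetry (br : mulLambdaBracket S) : Prop :=
  forall i j n : int,
    br (L i) (L j) (- n) = - autz S (- n) (br (L j) (L i) n).

(* At z^i w^j v^k: the coefficient of lambda^m mu^n. If
   {a_lambda b} = sum_p e_p lambda^p, then
   {{a_lambda b}_(lambda mu) c} = sum_p lambda^p {e_p _(lambda mu) c}, and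
   lambda^p (lambda mu)^q = lambda^m mu^n iff q = n and p = m - n. *)
Definition mul_jacobi (br : mulLambdaBracket S) : Prop :=
  forall i j k m n : int,
    br (L i) (br (L j) (L k) n) m - br (L j) (br (L i) (L k) m) n
    = br (br (L i) (L j) (m - n)) (L k) n.

End Adler.

(* Main.v *)
Require Import Defs.
From HB Require Import structures.
From mathcomp Require Import all_boot all_order all_algebra.
From mathcomp Require Import finmap classical_sets fsbigop.
From mathcomp Require Import ring zify.

(** Put {f, g} for the coefficient of lambda^0 in {f_lambda g}. This is an
S-invariant biderivation with {f_lambda g} = sum_n {S^n f, g} lambda^n, so the
theorem asks that {., .} be skewsymmetric and satisfy the Jacobi identity on
the elements M_xy = S^x(L_(y-x)), the entries of L(S) as a Z x Z matrix. Let
c(s,t,e) = [s <= e] - [t < e]. Reading off coefficients, the 3-Adler identity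
becomes
  {M_ab, M_cd} = sum_e c(a,d,e) M_ad M_ce M_eb - sum_e c(c,b,e) M_cb M_ae M_ed,
which is visibly skewsymmetric, and involves only indices e lying between those
on the left, so that Z may be replaced by a finite interval. Each monomial of
{M_xx', {M_yy', M_zz'}} joins the rows x, y, z to the columns x', y', z' along
a 3-cycle through two intermediate indices e, f. Under cyclic summation the
monomials with e, f on the same path cancel in pairs; the others cancel by a
relation between the signs c that only uses the order of e and f. *)

Set Implicit Arguments.
Unset Strict Implicit.
Unset Printing Implicit Defensive.

Import Order.TTheory GRing.Theory.
Local Open Scope ring_scope.

(* Summation against it is summation from s to t, with the convention that
   a sum with t < s is minus the sum over the e with t < e < s. *)
Definition signed_indicator (V : pzRingType) (disp : Order.disp_t)
  (T : porderType disp) (s t e : T) : V := (s <= e)%O%:R - (t < e)%O%:R.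
Arguments signed_indicator V {disp T}.

(** * Jacobi identity for a cubic bracket indexed by a finite ordered set *)

Section CubicBracket.
Context (V : comPzRingType) (B : V -> V -> V) (disp : Order.disp_t)
  (T : finOrderType disp) (M : T -> T -> V).
Local Notation cut := (signed_indicator V).

Definition half_bracket (a b c d : T) : V :=
  \sum_(e : T) cut a d e * (M a d * M c e * M e b).

Hypothesis BDl : forall a b c, B (a + b) c = B a c + B b c.
Hypothesis BDr : forall a b c, B a (b + c) = B a b + B a c.
Hypothesis BMl : forall a b c, B (a * b) c = B a c * b + B b c * a.
Hypothesis BMr : forall a b c, B a (b * c) = B a b * c + B a c * b.
Hypothesis BM : forall a b c d,
  B (M a b) (M c d) = half_bracket a b c d - half_bracket c d a b.

(** Pairing the terms that share a factor, [p] and [q] drop out of the differences; what remains is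
    settled by comparing [e] with [f]. *)
Lemma cut_relation (s t p q e f : T) :
  cut s t f * cut p f e - cut s t e * cut e q f
  - cut p t e * cut s t f + cut s q f * cut s t e = 0.
Proof.
rewrite /signed_indicator; case: (leP e f) => [ef|fe].
  have /implyP : (s <= e -> s <= f)%O by move=> se; exact: le_trans se ef.
  have /implyP : (t < e -> t < f)%O by move=> te; exact: lt_le_trans te ef.
  by case: (s <= e)%O; case: (s <= f)%O; case: (t < e)%O; case: (t < f)%O
    => // _ _; ring.
have /implyP : (s <= f -> s <= e)%O by move=> sf; exact: le_trans sf (ltW fe).
have /implyP : (t < f -> t < e)%O by move=> tf; exact: lt_trans tf fe.
by case: (s <= e)%O; case: (s <= f)%O; case: (t < e)%O; case: (t < f)%O
  => // _ _; ring.
Qed.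

Lemma bracket0r x : B x 0 = 0.
Proof. by apply: (addrI (B x 0)); rewrite -BDr !addr0. Qed.

Lemma bracket0l x : B 0 x = 0.
Proof. by apply: (addrI (B 0 x)); rewrite -BDl !addr0. Qed.

Lemma bracketNr x y : B x (- y) = - B x y.
Proof. by apply/eqP; rewrite -addr_eq0 -BDr addNr bracket0r. Qed.

Lemma bracketNl x y : B (- x) y = - B x y.
Proof. by apply/eqP; rewrite -addr_eq0 -BDl addNr bracket0l. Qed.

(** Additivity of [B] suffices, since the sign only takes the values -1, 0 and 1. *)
Lemma bracket_cutr x (s t e : T) y : B x (cut s t e * y) = cut s t e * B x y.
Proof.
rewrite /signed_indicator; case: (s <= e)%O; case: (t < e)%O;
  by rewrite ?subrr ?subr0 ?sub0r ?mul0r ?mulN1r ?mul1r ?bracket0r ?bracketNr.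
Qed.

Lemma bracket_cutl x (s t e : T) y : B (cut s t e * y) x = cut s t e * B y x.
Proof.
rewrite /signed_indicator; case: (s <= e)%O; case: (t < e)%O;
  by rewrite ?subrr ?subr0 ?sub0r ?mul0r ?mulN1r ?mul1r ?bracket0l ?bracketNl.
Qed.

Lemma bracket_genC a b c d : B (M a b) (M c d) = - B (M c d) (M a b).
Proof. by rewrite !BM opprB. Qed.

(** Skewsymmetry is known on entries; the two Leibniz rules carry it to cubic monomials. *)
Lemma bracket_halfC a b c d p q :
  B (half_bracket a b c d) (M p q) = - B (M p q) (half_bracket a b c d).
Proof.
rewrite /half_bracket.
rewrite (big_morph (B^~ (M p q)) (id1 := 0) (op1 := +%R)); last 2 first.
- by move=> u v; rewrite BDl.
- exact: bracket0l.
rewrite (big_morph (B (M p q)) (id1 := 0) (op1 := +%R)); last 2 first.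
- by move=> u v; rewrite BDr.
- exact: bracket0r.
rewrite -sumrN; apply: eq_bigr => e _.
rewrite bracket_cutl bracket_cutr !BMl !BMr.
by rewrite (bracket_genC a) (bracket_genC c) (bracket_genC e); ring.
Qed.

Definition double_part1 (x x' y y' z z' e f : T) : V :=
  cut y z' e * cut x y' f * (M x y' * M y z' * (M z e * M e f * M f x'))
  - cut y z' e * cut e x' f * (M x f * M f y' * M y z' * (M z e * M e x'))
  - cut z y' e * cut x y' f * (M x y' * (M y e * M e z') * (M z f * M f x')).

Definition double_part2 (x x' y y' z z' e f : T) : V :=
  cut y z' e * cut x e f * (M x e * M e y' * M y z' * (M z f * M f x'))
  - cut y z' e * cut z x' f * (M x f * M f e * M e y' * M y z' * M z x')
  + cut z y' e * cut z x' f * (M x f * M f y' * (M y e * M e z') * M z x').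

(* The part of [{M_xx', {M_yy', M_zz'}}] consisting of the monomials in which
   the rows x, y, z are joined to the columns y', z', x'. The summation indices
   are interchanged in [double_part2] so that, after cyclic permutation of
   (x, y, z), the cancellation holds for each pair (e, f) separately. *)
Definition double_part (x x' y y' z z' : T) : V :=
  \sum_e \sum_f
   (double_part1 x x' y y' z z' e f + double_part2 x x' y y' z z' f e).

Lemma double_partE x x' y y' z z' :
  double_part x x' y y' z z' = \sum_e \sum_f
   (double_part1 x x' y y' z z' e f + double_part2 x x' y y' z z' e f).
Proof.
rewrite /double_part; under eq_bigr do rewrite big_split.
under [RHS]eq_bigr do rewrite big_split.
by rewrite !big_split /=; congr (_ + _); exact: exchange_big.
Qed.

(** The three pairs of terms come from bracketing with [M z e], [M e y'] and [M y z'], in this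
    order. The first two pairs join the rows x, y, z to y', z', x'; the last joins them to z', x',
    y', so it goes to the part with y and z exchanged. *)
Lemma bracket_half x x' y y' z z' :
  B (M x x') (half_bracket y y' z z') = \sum_e \sum_f
   (cut y z' e * cut x e f * (M x e * M e y' * M y z' * (M z f * M f x'))
  - cut y z' e * cut z x' f * (M x f * M f e * M e y' * M y z' * M z x')
  + cut y z' e * cut x y' f * (M x y' * M y z' * (M z e * M e f * M f x'))
  - cut y z' e * cut e x' f * (M x f * M f y' * M y z' * (M z e * M e x'))
  + cut y z' e * cut x z' f * (M x z' * (M y f * M f x') * (M z e * M e y'))
  - cut y z' e * cut y x' f * (M x f * M f z' * M y x' * (M z e * M e y'))).
Proof.
rewrite {1}/half_bracket (big_morph (B (M x x')) (id1 := 0) (op1 := +%R)).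
- apply: eq_bigr => e _.
  rewrite bracket_cutr !BMr !BM /half_bracket -!sumrB.
  rewrite !mulr_suml -big_split mulr_suml -big_split mulr_sumr.
  by apply: eq_bigr => f _ /=; ring.
- by move=> u v; rewrite BDr.
- exact: bracket0r.
Qed.

Lemma double_bracketE x x' y y' z z' :
  B (M x x') (B (M y y') (M z z'))
  = double_part x x' y y' z z' - double_part x x' z z' y y'.
Proof.
rewrite BM BDr bracketNr !bracket_half !double_partE -!sumrB.
apply: eq_bigr => e _; rewrite -!sumrB; apply: eq_bigr => f _.
by rewrite /double_part1 /double_part2; ring.
Qed.

Lemma double_part_cyclic x x' y y' z z' :
  double_part x x' y y' z z' + double_part y y' z z' x x'
  + double_part z z' x x' y y' = 0.
Proof.
rewrite /double_part -!big_split big1 // => e _ /=.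
rewrite -!big_split big1 // => f _ /=.
rewrite /double_part1 /double_part2.
have h1 := cut_relation z x' y y' e f.
have h2 := cut_relation x y' z z' e f.
have h3 := cut_relation y z' x x' e f.
(* Six of the 18 terms, those with [e] and [f] on one path, cancel in pairs. The other twelve share
   three monomials, whose coefficients are the left-hand sides of [h1], [h2], [h3]. *)
transitivity (
   (cut z x' f * cut y f e - cut z x' e * cut e y' f
  - cut y x' e * cut z x' f + cut z y' f * cut z x' e) *
     (M x e * M e y' * (M y f * M f z') * M z x')
 + (cut x y' f * cut z f e - cut x y' e * cut e z' f
  - cut z y' e * cut x y' f + cut x z' f * cut x y' e) *
     (M y e * M e z' * (M z f * M f x') * M x y')
 + (cut y z' f * cut x f e - cut y z' e * cut e x' f
  - cut x z' e * cut y z' f + cut y x' f * cut y z' e) *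
     (M z e * M e x' * (M x f * M f y') * M y z')).
  by ring.
by rewrite h1 h2 h3 !mul0r !addr0.
Qed.

Lemma cubic_bracket_jacobi x x' y y' z z' :
  B (M x x') (B (M y y') (M z z')) - B (M y y') (B (M x x') (M z z'))
  = B (B (M x x') (M y y')) (M z z').
Proof.
apply/eqP; rewrite -subr_eq0; apply/eqP.
have -> : B (B (M x x') (M y y')) (M z z') = - B (M z z') (B (M x x') (M y y')).
  by rewrite !BM BDl BDr bracketNl bracketNr !bracket_halfC opprD.
rewrite !double_bracketE.
(* The six parts form two orbits under cyclic permutation, with opposite signs. *)
have h1 := double_part_cyclic x x' y y' z z'.
have h2 := double_part_cyclic x x' z z' y y'.
rewrite -[RHS](subrr 0) -{1}h1 -h2; ring.
Qed.

End CubicBracket.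

(** * Integer powers of [S] and their passage through the bracket *)

Section ShiftPowers.
Context (F : fieldType) (V : comAlgType F) (S : algAut V).
Implicit Types (m n : int) (x y : V).

Lemma autzS n x : autz S (n + 1) x = S (autz S n x).
Proof.
case: n => [k|[|k]].
- by rewrite (_ : Posz k + 1 = Posz k.+1) //; lia.
- by rewrite /= aut_invK.
- by rewrite (_ : Negz k.+1 + 1 = Negz k); [rewrite /= aut_invK | lia].
Qed.

#[global] Arguments autz : simpl never.

Lemma autzSr n x : autz S (n + 1) x = autz S n (S x).
Proof.
elim/int_ind: n => [//|n IH|n IH].
  by rewrite -addn1 PoszD autzS IH -autzS.
apply: (can_inj (aut_funK S)); rewrite -!autzS.
by rewrite (_ : - n.+1%:Z + 1 = - n%:Z) ?IH//; lia.
Qed.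

Lemma autzD m n x : autz S (m + n) x = autz S m (autz S n x).
Proof.
elim/int_ind: m n => [n|m IH n|m IH n]; first by rewrite add0r.
- rewrite -addn1 PoszD autzSr -autzS -IH; congr (autz S _ x); lia.
- rewrite (_ : - m.+1%:Z + n = - m%:Z + (n - 1)); last lia.
  have -> : autz S n x = S (autz S (n - 1) x) by rewrite -autzS subrK.
  by rewrite IH -autzSr; congr (autz S _ _); lia.
Qed.

Lemma autzNS (n : nat) x : S (autz S (- n.+1%:Z) x) = autz S (- n%:Z) x.
Proof. by rewrite -autzS; congr (autz S _ _); lia. Qed.

Lemma autz_zmod_morphism n : zmod_morphism (autz S n).
Proof.
elim/int_ind: n => [//|n IH|n IH] x y.
  by rewrite -addn1 PoszD !autzS IH raddfB.
by apply: (can_inj (aut_funK S)); rewrite raddfB /= !autzNS IH.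
Qed.

Lemma autz_monoid_morphism n : monoid_morphism (autz S n).
Proof.
elim/int_ind: n => [|n [IH1 IHM]|n [IH1 IHM]].
- by split.
- split=> [|x y]; first by rewrite -addn1 PoszD autzS IH1 rmorph1.
  by rewrite -addn1 PoszD !autzS IHM rmorphM.
- split=> [|x y]; apply: (can_inj (aut_funK S)).
    by rewrite autzNS IH1 rmorph1.
  by rewrite rmorphM /= !autzNS IHM.
Qed.

HB.instance Definition _ n := GRing.isZmodMorphism.Build V V (autz S n)
  (autz_zmod_morphism n).
HB.instance Definition _ n := GRing.isMonoidMorphism.Build V V (autz S n)
  (autz_monoid_morphism n).

Context (br : mulLambdaBracket S).

Lemma br_shiftl a x y n : br (autz S a x) y n = br x y (n + a).
Proof.
elim/int_ind: a n => [n|a IH n|a IH n]; first by rewrite addr0.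
- by rewrite -addn1 PoszD autzS mlb_sesquil IH; congr (br x y _); lia.
- rewrite -[n in LHS](subrK 1) -mlb_sesquil -autzS.
  by rewrite (_ : - a.+1%:Z + 1 = - a%:Z) ?IH; [congr (br x y _)|]; lia.
Qed.

Lemma br_shiftr c x y n : br x (autz S c y) n = autz S c (br x y (n - c)).
Proof.
elim/int_ind: c n => [n|c IH n|c IH n]; first by rewrite subr0.
- rewrite -addn1 PoszD !autzS mlb_sesquir IH.
  by congr (S (autz S _ (br x y _))); lia.
- apply: (can_inj (aut_funK S)); rewrite -autzS.
  have e : - c.+1%:Z + 1 = - c%:Z by lia.
  rewrite e -[n in LHS](addrK 1) -mlb_sesquir -autzS e IH.
  by congr (autz S _ (br x y _)); lia.
Qed.

Lemma br0E x y n : br x y n = br (autz S n x) y 0.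
Proof. by rewrite br_shiftl add0r. Qed.

End ShiftPowers.

(** * Finitely supported sums rewritten over a finite window *)

Section FiniteSupportSums.
Context (V : nmodType).
Local Open Scope classical_set_scope.

Lemma fsbig_setT_seq (T : choiceType) (r : seq T) (F : T -> V) :
  uniq r -> (forall e, e \notin r -> F e = 0) ->
  \sum_(e \in [set: T]) F e = \sum_(e <- r) F e.
Proof.
move=> ur h; rewrite (fsbigE r)//; last by move=> e _; exact: h.
by apply: eq_bigl => e; rewrite in_setT.
Qed.

Lemma fsbig_single (T : choiceType) (F : T -> V) (c : T) :
  (forall e, e != c -> F e = 0) -> \sum_(e \in [set: T]) F e = F c.
Proof.
move=> h; rewrite (fsbig_setT_seq (r := [:: c])) ?big_seq1// => e.
by rewrite inE; exact: h.
Qed.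

Lemma fsbig_window (F : int -> V) (o : int) (n : nat) :
  (forall e, ~~ (o <= e < o + n%:Z) -> F e = 0) ->
  \sum_(e \in [set: int]) F e = \sum_(k < n) F (o + k%:Z).
Proof.
move=> h; rewrite (fsbig_setT_seq (r := [seq o + k%:Z | k : 'I_n])).
- by rewrite big_image.
- by rewrite map_inj_uniq ?enum_uniq// => i j ij; apply: val_inj => /=; lia.
- move=> e eN; apply: h; apply: contra eN => oe.
  have lt : (absz (e - o) < n)%N by lia.
  by apply/mapP; exists (Ordinal lt); rewrite ?mem_enum//=; lia.
Qed.

(** Puts half-line sums with different starting points [p] over one common window, so that they can
    be subtracted termwise. *)
Lemma fsbig_nat_window (G : int -> V) (p K o : int) (n : nat) :
  (forall e, K <= e -> G e = 0) -> o <= p -> p <= o + n%:Z -> K <= o + n%:Z ->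
  \sum_(k \in [set: nat]) G (p + k%:Z)
  = \sum_(k < n) (if p <= o + k%:Z then G (o + k%:Z) else 0).
Proof.
move=> hG op pn Kn.
have [l [m [nE ->]]] : exists l m : nat, n = (l + m)%N /\ p = o + l%:Z.
  by exists (absz (p - o)), (n - absz (p - o))%N; split; lia.
have G0 k : (m <= k)%N -> G (o + l%:Z + k%:Z) = 0.
  by move=> mk; apply: hG; lia.
rewrite nE big_split_ord /= [X in _ = X + _]big1 ?add0r; last first.
  by move=> k _; rewrite ifF//; have := ltn_ord k; lia.
rewrite (fsbig_setT_seq (r := index_iota 0 m)) ?iota_uniq//; last first.
  by move=> k; rewrite mem_index_iota => km; apply: G0; lia.
rewrite big_mkord; apply: eq_bigr => k _.
by rewrite PoszD addrA ifT//; lia.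
Qed.

End FiniteSupportSums.

(** * Coefficients of the right-hand side of the 3-Adler identity *)

Section Adler.
Context (F : fieldType) (V : comAlgType F) (S : algAut V) (L : int -> V).
Local Notation cut := (signed_indicator V).
Local Open Scope classical_set_scope.

Lemma sum_indicator (m : nat) (c : int) :
  c < m%:Z -> \sum_(k < m) (k%:Z == c)%R%:R = (0 <= c)%R%:R :> V.
Proof.
case: c => c cm; last by rewrite big1.
rewrite (bigD1 (Ordinal cm))//= eqxx big1 ?addr0// => k kc.
rewrite (_ : (k%:Z == c) = false)//; apply: contra_neqF kc => kc.
by apply: val_inj => /=; lia.
Qed.

(** For n = -i, the adjoint contributes only at k = j and the shifted symbol only at k = -1 - i,
    with equal values up to sign. The indicators say whether these k are natural numbers. *)
Lemma mul_delta_adj_shiftE (i j n : int) :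
  mul_delta S (series_sub (adj_symb S L) (mul_shift S (symb_w L))) i j n
  = if n == - i then ((0 <= j)%R%:R - (0 < n)%R%:R) * autz S n (L (j - n))
    else 0.
Proof.
rewrite /mul_delta /series_sub /adj_symb /mul_shift /symb_w.
have [->|ni] := eqVneq n (- i); last first.
  rewrite fsbig1// => k _; move: (k : nat) => {}k.
  by rewrite !ifF ?raddf0 ?addr0 ?raddf0//; lia.
have E (k : nat) : autz S k%:Z
     ((if (j - k%:Z == 0) && (- i - k%:Z == - (i + k%:Z)) then
        autz S (- (i + k%:Z)) (L (i + k%:Z)) else 0)
      - S (if (i + k%:Z + 1 == 0) && (- i - k%:Z - 1 == 0) then
        L (j - k%:Z - 1) else 0))
   = ((k%:Z == j)%R%:R - (k%:Z == - 1 - i)%R%:R) * autz S (- i) (L (j - - i)).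
  rewrite raddfB mulrBl; congr (_ - _).
    have [<-|kj] := eqVneq k%:Z j; last by rewrite ifF ?raddf0 ?mul0r//; lia.
    rewrite ifT /= ?mul1r -?autzD; last by lia.
    by congr (autz S _ (L _)); lia.
  have [ki|kj] := eqVneq k%:Z (- 1 - i); last first.
    by rewrite ifF ?raddf0 ?raddf0 ?mul0r//; lia.
  rewrite ifT /= ?mul1r -?autzSr -?autzD; last by lia.
  by congr (autz S _ (L _)); lia.
rewrite (fsbig_setT_seq (r := index_iota 0 (`|j| + `|i|).+1)) ?iota_uniq//;
  last first.
  move=> k; rewrite mem_index_iota => km; rewrite E.
  rewrite (_ : (k%:Z == j) = false); last by lia.
  rewrite (_ : (k%:Z == - 1 - i) = false); last by lia.
  by rewrite subrr mul0r.
under eq_bigr do rewrite E.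
rewrite -mulr_suml big_mkord sumrB !sum_indicator; try lia.
by congr ((_ - _%:R) * _); lia.
Qed.

Lemma mul_op_adj_shiftE (i j n : int) :
  mul_op S L (mul_symb_z L (mul_delta S
    (series_sub (adj_symb S L) (mul_shift S (symb_w L))))) i j n
  = \sum_(e \in [set: int]) cut n j e *
      (autz S n (L (j - n)) * (L e * autz S e (L (i + n - e)))).
Proof.
apply: eq_fsbigr => a _; rewrite /mul_symb_z (fsbig_single (c := i + n - a)).
  rewrite mul_delta_adj_shiftE ifT; last by lia.
  rewrite !rmorphM rmorphB !rmorph_nat /= -autzD /signed_indicator.
  (* Complementing both conditions turns [a <= j] - [a < n] into [cut n j a]. *)
  rewrite (_ : (0 <= j - a) = ~~ (j < a)); last by lia.
  rewrite (_ : (0 < n - a) = ~~ (n <= a)); last by lia.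
  rewrite (_ : a + (n - a) = n); last by lia.
  rewrite (_ : j - a - (n - a) = j - n); last by lia.
  by case: (_ <= _); case: (_ < _) => /=; ring.
by move=> b bi; rewrite mul_delta_adj_shiftE ifF ?mulr0//; lia.
Qed.

Lemma mul_delta_symbE (i j n : int) :
  mul_delta S (symb_w_adj_symb S L) i j n
  = if n == - i then
      \sum_(k \in [set: nat])
        autz S k%:Z (L (j - k%:Z)) * autz S n (L (k%:Z - n))
    else 0.
Proof.
rewrite /mul_delta /symb_w_adj_symb; have [->|ni] := eqVneq n (- i).
  apply: eq_fsbigr => k _; move: (k : nat) => {}k; rewrite ifT; last by lia.
  rewrite rmorphM /= -autzD; congr (_ * autz S _ (L _)); lia.
rewrite fsbig1// => k _; move: (k : nat) => {}k.
by rewrite ifF ?raddf0//; lia.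
Qed.

(** Below the window both indicators are 0, above it both are 1. *)
Lemma signed_indicator_out (o : int) (N : nat) (s t e : int) :
  o <= s < o + N%:Z -> o <= t < o + N%:Z -> ~~ (o <= e < o + N%:Z) ->
  cut s t e = 0.
Proof.
move=> hs ht he; rewrite /signed_indicator.
by rewrite (_ : (s <= e)%O = (t < e)%O) ?subrr//; lia.
Qed.

(** With p = i + n, both products are L(p) times sums of the same terms over half-lines, starting at
    0 and at p + 1. The common tails cancel. *)
Lemma symb_delta_shiftE (o : int) (N : nat) (i j n : int) :
  in_laurent_Sinv L \/ in_laurent_S L ->
  o <= 0 < o + N%:Z -> o <= i + n < o + N%:Z ->
  let Y := mul_delta S (symb_w_adj_symb S L) in
  mul_symb_z L Y i j n - mul_op S L (mul_shift S Y) i j n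
  = L (i + n) * \sum_(k < N) cut 0 (i + n) (o + k%:Z) *
      (autz S (o + k%:Z) (L (j - (o + k%:Z))) * autz S n (L (o + k%:Z - n))).
Proof.
move=> hL o0 oin Y; set p : int := i + n in oin *.
(* The parameter [c] records a power of [S] applied to the term of index [e], so that the outer
   [autz S (p + 1)] can be absorbed. *)
pose G (c e : int) := autz S (c + e) (L (j - e)) * autz S (c + n) (L (e - n)).
have GD c d e : autz S c (G d e) = G (c + d) e.
  by rewrite /G rmorphM /= -!autzD !addrA.
(* For large [e] the second factor vanishes if L is in V((S^-1)), the first if L is in V((S)). *)
have [K GK] : exists K : int, forall c e : int, K <= e -> G c e = 0.
  case: hL => [[K LK]|[K LK]].
    exists (K + n + 1) => c e Ke.
    by rewrite /G (LK (e - n)) ?raddf0 ?mulr0//; lia.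
  exists (j - K + 1) => c e Ke.
  by rewrite /G (LK (j - e)) ?raddf0 ?mul0r//; lia.
have -> : mul_symb_z L Y i j n = L p * \sum_(k \in [set: nat]) G 0 (0 + k%:Z).
  rewrite /mul_symb_z (fsbig_single (c := p)).
    rewrite /Y mul_delta_symbE ifT; last by lia.
    by congr (_ * _); apply: eq_fsbigr => k _; rewrite /G !add0r.
  by move=> b bp; rewrite /Y mul_delta_symbE ifF ?mulr0//; lia.
have -> : mul_op S L (mul_shift S Y) i j n
    = L p * autz S (p + 1)
        (\sum_(k \in [set: nat]) G (- (p + 1)) (p + 1 + k%:Z)).
  rewrite /mul_op /mul_shift (fsbig_single (c := p)).
    rewrite /Y mul_delta_symbE ifT; last by lia.
    congr (_ * _); rewrite -autzSr; congr autz.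
    apply: eq_fsbigr => k _; move: (k : nat) => {}k.
    by rewrite /G; congr (autz S _ (L _) * autz S _ (L _)); lia.
  by move=> b bp; rewrite /Y mul_delta_symbE ifF ?raddf0 ?raddf0 ?mulr0//; lia.
(* The window [-B, B) contains both starting points and reaches [K]. *)
pose B := (`|K| + `|p| + 2)%N.
rewrite !(fsbig_nat_window (o := - B%:Z) (n := B.*2) (GK _)); try lia.
rewrite raddf_sum -mulrBr -sumrB; congr (_ * _).
pose H (e : int) := cut 0 p e * G 0 e.
transitivity (\sum_(k < B.*2) H (- B%:Z + k%:Z)).
  apply: eq_bigr => k _; move: (- B%:Z + k%:Z) => e.
  rewrite /H /signed_indicator.
  rewrite (_ : (p + 1 <= e) = (p < e)%O); last by lia.
  case: (0 <= e)%O; case: (p < e)%O; rewrite /= ?GD ?raddf0 ?subrr; ring.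
rewrite -fsbig_window; last first.
  move=> e he; rewrite /H (@signed_indicator_out (- B%:Z) B.*2) ?mul0r//; lia.
rewrite (@fsbig_window _ _ o N); last first.
  by move=> e he; rewrite /H (@signed_indicator_out o N) ?mul0r.
by apply: eq_bigr => k _; rewrite /H /G !add0r.
Qed.

End Adler.

(** * The 3-Adler identity as a cubic bracket of matrix entries *)

Section Entries.
Context (F : fieldType) (V : comAlgType F) (S : algAut V) (L : int -> V).
Local Notation cut := (signed_indicator V).

Definition entry (x y : int) : V := autz S x (L (y - x)).

Lemma autz_entry c x y : autz S c (entry x y) = entry (c + x) (c + y).
Proof. by rewrite /entry -autzD; congr (autz S _ (L _)); lia. Qed.

(** This is the cubic formula for {M_ab, M_cd} with (a, b, c, d) = (n, i + n, 0, j). *)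
Lemma adler_rhsE (o : int) (N : nat) (i j n : int) :
  in_laurent_Sinv L \/ in_laurent_S L ->
  o <= 0 < o + N%:Z -> o <= n < o + N%:Z ->
  o <= j < o + N%:Z -> o <= i + n < o + N%:Z ->
  adler_rhs S L i j n =
  \sum_(k < N) cut n j (o + k%:Z) *
    (entry n j * entry 0 (o + k%:Z) * entry (o + k%:Z) (i + n))
  - \sum_(k < N) cut 0 (i + n) (o + k%:Z) *
    (entry 0 (i + n) * entry n (o + k%:Z) * entry (o + k%:Z) j).
Proof.
move=> hL o0 on oj oin; rewrite {1}/adler_rhs {1}/series_sub.
rewrite [X in _ - X]/series_sub (symb_delta_shiftE S j hL o0 oin).
rewrite mul_op_adj_shiftE (@fsbig_window _ _ o N); last first.
  by move=> e he; rewrite (signed_indicator_out _ on oj he) mul0r.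
congr (_ - _); first by apply: eq_bigr => k _; rewrite /entry !subr0 mulrA.
rewrite mulr_sumr; apply: eq_bigr => k _; rewrite /entry !subr0 /=.
rewrite (_ : autz S 0 (L (i + n)) = L (i + n))//; ring.
Qed.

Lemma entry_window (K : nat) (x y : int) : (`|x| <= K)%N -> (`|y| <= K)%N ->
  exists a b : 'I_(K.*2.+1),
    entry x y = entry (- K%:Z + a%:Z) (- K%:Z + b%:Z).
Proof.
move=> xK yK.
have ltx : (absz (x + K%:Z)%R < K.*2.+1)%N by lia.
have lty : (absz (y + K%:Z)%R < K.*2.+1)%N by lia.
by exists (Ordinal ltx), (Ordinal lty); congr entry => /=; lia.
Qed.

Context (br : mulLambdaBracket S).

Lemma br_autz c x y : br (autz S c x) (autz S c y) 0 = autz S c (br x y 0).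
Proof. by rewrite br_shiftr br_shiftl sub0r addNr. Qed.

Lemma br_entry (o : int) (N : nat) (a b c d : 'I_N) :
  in_laurent_Sinv L \/ in_laurent_S L -> adler3 L br ->
  let M (k l : 'I_N) := entry (o + k%:Z) (o + l%:Z) in
  br (M a b) (M c d) 0 = half_bracket M a b c d - half_bracket M c d a b.
Proof.
move=> hL hA M.
(* Invariance under [S] moves row [c] to row 0, where the bracket is a coefficient of the 3-Adler
   identity. *)
have -> : M a b = autz S (o + c%:Z) (autz S (a%:Z - c%:Z) (L (b%:Z - a%:Z))).
  by rewrite -autzD; congr (autz S _ (L _)); lia.
have -> : M c d = autz S (o + c%:Z) (L (d%:Z - c%:Z)).
  by congr (autz S _ (L _)); lia.
rewrite br_autz -br0E.
have := hA (b%:Z - a%:Z) (d%:Z - c%:Z) (a%:Z - c%:Z).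
rewrite /bracket_series => ->.
have := ltn_ord a; have := ltn_ord b; have := ltn_ord c; have := ltn_ord d.
(* After this translation the window starts at -c. *)
move=> ? ? ? ?; rewrite (@adler_rhsE (- c%:Z) N) //; try lia.
rewrite raddfB; congr (_ - _); rewrite raddf_sum; apply: eq_bigr => k _;
  rewrite /= /signed_indicator !rmorphM rmorphB !rmorph_nat /= !autz_entry;
  congr ((_%:R - _%:R) * (_ * _ * _)); rewrite /M; try (by congr entry; lia);
  rewrite ?leEord ?ltEord; lia.
Qed.

End Entries.

(** * Reduction of both identities to entries in a finite window *)

Theorem proposition7p2 (F : fieldType) (charF : [pchar F] =i pred0)
    (V : comAlgType F) (S : algAut V) (br : mulLambdaBracket S)
    (L : int -> V) (hL : in_laurent_Sinv L \/ in_laurent_S L)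
    (hA : adler3 L br) :
  mul_skewsymmetry L br /\ mul_jacobi L br.
Proof.
have BDl a b c : br (a + b) c 0 = br a c 0 + br b c 0.
  by have := mlb_linearl br c 0 1 a b; rewrite !scale1r.
have BDr a b c : br a (b + c) 0 = br a b 0 + br a c 0.
  by have := mlb_linearr br a 0 1 b c; rewrite !scale1r.
have BMl a b c : br (a * b) c 0 = br a c 0 * b + br b c 0 * a.
  exact: mlb_leibnizr.
have BMr a b c : br a (b * c) 0 = br a b 0 * c + br a c 0 * b.
  exact: mlb_leibnizl.
have LE x y : autz S x (L y) = entry S L x (x + y).
  by congr (autz S _ (L _)); lia.
split=> [i j n|i j k m n].
- have -> : autz S (- n) (br (L j) (L i) n) = br (L j) (autz S (- n) (L i)) 0.
    by rewrite br_shiftr sub0r opprK.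
  rewrite br0E -[L j]/(autz S 0 (L j)) !LE.
  pose K := (`|n| + `|i| + `|j|)%N.
  have [||x [x' ->]] := @entry_window _ _ S L K (- n) (- n + i); try lia.
  have [||y [y' ->]] := @entry_window _ _ S L K 0 (0 + j); try lia.
  by rewrite !(br_entry _ _ _ _ _ hL hA) opprB.
(* Applying [S] to the power n turns the inner coefficient into {S^m L_i, S^n L_j}, so the three
   entries lie in rows m, n and 0. *)
- have -> : br (br (L i) (L j) (m - n)) (L k) n
      = br (br (autz S m (L i)) (autz S n (L j)) 0) (L k) 0.
    by rewrite [LHS]br0E -br_shiftr [br _ _ m]br0E.
  rewrite ![br _ _ m]br0E ![br _ _ n]br0E -[L k]/(autz S 0 (L k)) !LE.
  pose K := (`|m| + `|n| + `|i| + `|j| + `|k|)%N.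
  have [||x [x' ->]] := @entry_window _ _ S L K m (m + i); try lia.
  have [||y [y' ->]] := @entry_window _ _ S L K n (n + j); try lia.
  have [||z [z' ->]] := @entry_window _ _ S L K 0 (0 + k); try lia.
  exact: (cubic_bracket_jacobi BDl BDr BMl BMr
    (fun a b c d => br_entry _ a b c d hL hA)).
Qed.
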